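(* Let $\mathcal{P}$ be a nonempty poset such that (i) $\mathcal{P}={\downarrow}\mathcal{S}$ for some finite subposet $\mathcal{S}\subseteq\mathcal{P}$, and (ii) for all subposets $\mathcal{A},\mathcal{B}\subseteq\mathcal{P}$ with $\mathcal{A}\cap\mathcal{B}\neq\emptyset$, each of which is of the form ${\downarrow}p$ or ${\downarrow}p\cap{\uparrow}q$ for some $p,q\in\mathcal{P}$, we have $\max(\mathcal{A}\cap\mathcal{B})\neq\emptyset$. Define recursively full subposets of $\mathcal{P}$ by $\mathcal{S}_0:=\max\mathcal{P}$ and $$\mathcal{S}_n:=\mathcal{S}_{n-1}\sqcup\max\{p\in\mathcal{P} : {\uparrow}p\cap\mathcal{S}_{n-1}\text{ is not connected}\}\qquad(n\ge 1),$$ and let $\mathcal{S}_\infty:=\bigcup_{n=0}^{\infty}\mathcal{S}_n$ (a full subposet of $\mathcal{P}$). Then: (1) The full embedding $F:\mathcal{S}_\infty\hookrightarrow\mathcal{P}$ is final. (2) If $\mathcal{Q}$ is a (not necessarily full) subposet of $\mathcal{P}$ whose embedding $G:\mathcal{Q}\hookrightarrow\mathcal{P}$ is final, then every element of $\mathcal{S}_\infty$ is an element of $\mathcal{Q}$. (3) There is an $\ell\le\#\max\mathcal{P}-1$ such that $\mathcal{S}_\ell=\mathcal{S}_{\ell+1}=\cdots=\mathcal{S}_\infty$. Furthermore, this bound is sharp.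
   Context: For a poset $\mathcal{P}$ and $p\in\mathcal{P}$, ${\uparrow}p=\{q\in\mathcal{P}: p\le q\}$ and ${\downarrow}p=\{q\in\mathcal{P}:q\le p\}$; for $\mathcal{S}\subseteq\mathcal{P}$, ${\downarrow}\mathcal{S}=\bigcup_{s\in\mathcal{S}}{\downarrow}s$. For a subset $\mathcal{A}$ of $\mathcal{P}$, $\max\mathcal{A}$ is the set of maximal elements of $\mathcal{A}$ (with the order induced from $\mathcal{P}$), and $\#$ denotes cardinality. A subposet $\mathcal{Q}$ of $\mathcal{P}$ is a subset with a partial order contained in that of $\mathcal{P}$; it is full if its order is the restriction of the order of $\mathcal{P}$. A poset is connected if it is nonempty and any two elements are joined by a finite zigzag of comparable elements within it; ${\uparrow}p\cap\mathcal{S}_{n-1}$ carries the order induced from $\mathcal{P}$. Posets are viewed as categories (a unique morphism $p\to q$ exactly when $p\le q$). A poset morphism $F:\mathcal{Q}\to\mathcal{P}$ is final if for every $p\in\mathcal{P}$ the comma category $p/F$ is nonempty and connected; for a subposet embedding, this means that $\{q\in\mathcal{Q}:p\le q \text{ in }\mathcal{P}\}$, with the order of $\mathcal{Q}$, is nonempty and connected for every $p\in\mathcal{P}$. *)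

(* Defs.v *)
From Stdlib Require Export Relation_Operators.
From HB Require Import structures.
From mathcomp Require Export all_boot all_order.
From mathcomp Require Export mathcomp_extra boolp classical_sets functions.
From mathcomp Require Export cardinality.

(* Posets are porderTypes; classically this is no restriction, since every type
   has a choiceType structure and every relation is boolean. *)

Set Implicit Arguments.
Unset Strict Implicit.
Unset Printing Implicit Defensive.

Import Order.TTheory.
Local Open Scope order_scope.
Local Open Scope classical_set_scope.

(* Connectedness of the subset A of I ordered by r.  The zigzags stay inside A,
   and the empty set is not connected. *)
Definition zigzag (I : Type) (r : I -> I -> Prop) (A : set I) : I -> I -> Prop :=
  clos_refl_sym_trans I (fun x y => [/\ A x, A y & r x y]).

Definition poset_connected (I : Type) (r : I -> I -> Prop) (A : set I) : Prop :=
  A !=set0 /\ forall x y, A x -> A y -> zigzag r A x y.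

Section Poset.
Context {d : Order.disp_t} {P : porderType d}.
Implicit Types (p q : P) (A B : set P).

Definition up p : set P := [set q | p <= q].
Definition dn p : set P := [set q | q <= p].

Definition maximals A : set P :=
  [set a | A a /\ forall b, A b -> a <= b -> b = a].

Definition lower_piece A : Prop :=
  exists p, A = dn p \/ exists q, A = dn p `&` up q.

(* A subposet need not be full: its order lives on the subtype of elements of
   the carrier and is only contained in the order of P. *)
Record subposet := Subposet {
  carrier :> set P;
  sub_le : carrier -> carrier -> Prop;
  sub_le_refl : forall x, sub_le x x;
  sub_le_anti : forall x y, sub_le x y -> sub_le y x -> x = y;
  sub_le_trans : forall x y z, sub_le x y -> sub_le y z -> sub_le x z;
  sub_le_incl : forall x y, sub_le x y -> val x <= val y }.

Definition full_subposet A : subposet.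
Proof.
apply: (@Subposet A (fun x y => val x <= val y)) => //.
- by move=> x y xy yx; apply: val_inj; apply/eqP; rewrite eq_le xy yx.
- move=> x y z; exact: le_trans.
Defined.

(* The comma category p/F of a morphism F : I -> P is the full subposet of
   those i with p <= F i, since P has at most one morphism p -> F i. *)
Definition final (I : Type) (leI : I -> I -> Prop) (F : I -> P) : Prop :=
  forall p, poset_connected leI [set i | p <= F i].

Definition embedding (Q : subposet) : carrier Q -> P := fun x => val x.

Definition final_subposet (Q : subposet) : Prop :=
  final (@sub_le Q) (embedding (Q := Q)).

Fixpoint stage (n : nat) : set P :=
  if n is m.+1 then
    stage m `|`
      maximals [set p | ~ poset_connected (fun x y => x <= y) (up p `&` stage m)]
  else maximals [set: P].

Lemma stage_disjoint n :
  stage n `&`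
    maximals [set p | ~ poset_connected (fun x y => x <= y) (up p `&` stage n)]
  = set0.
Proof.
rewrite -subset0 => p [Sp [+ _]]; apply.
have Ap : (up p `&` stage n) p by split => //; exact: lexx.
split; [by exists p | move=> x y Ax Ay].
apply: (rst_trans _ _ _ p); last by apply: rst_step; case: (Ay).
by apply/rst_sym/rst_step; case: (Ax).
Qed.

Definition stage_infty : set P := \bigcup_n stage n.

End Poset.

Arguments subposet {d} P.
Arguments stage {d} P n.
Arguments stage_infty {d} P.

Definition admissible (d : Order.disp_t) (P : porderType d) : Prop :=
  [/\ [set: P] !=set0,
      exists S : set P, finite_set S /\ [set: P] = \bigcup_(s in S) dn s
    & forall A B : set P, lower_piece A -> lower_piece B ->
        A `&` B !=set0 -> maximals (A `&` B) !=set0].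

Definition stabilizes_at (d : Order.disp_t) (P : porderType d) (l : nat) : Prop :=
  forall n, (l <= n)%N -> stage P n = stage_infty P.

(* Main.v *)
(* The key fact is that above a point lying below at most n+1 maximal elements,
   stage n is connected: a point that is maximal among the common lower bounds of
   two separated maximal elements can only be dominated by points lying below
   fewer maximal elements.  Hence no disconnected points remain at stage
   #max P - 1, which gives finality and stabilization at once. *)

From HB Require Import structures.
Require Import Defs.

Set Implicit Arguments.
Unset Strict Implicit.
Unset Printing Implicit Defensive.

Import Order.TTheory.
Local Open Scope order_scope.
Local Open Scope classical_set_scope.
Local Open Scope card_scope.

(** * Zigzags, counting and cardinality *)

Lemma zigzag_sub (I : Type) (r : I -> I -> Prop) (A B : set I) x y :
  A `<=` B -> zigzag r A x y -> zigzag r B x y.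
Proof.
move=> AB; elim=> {x y} [x y [Ax Ay xy]|x|x y _ yx|x y z _ xy _ yz].
- by apply: rst_step; split => //; exact: AB.
- exact: rst_refl.
- exact: rst_sym.
- exact: rst_trans xy yz.
Qed.

(** Used with [T] either a cut that separates two points or a property carried along a zigzag. *)
Lemma zigzag_invariant (I : Type) (r : I -> I -> Prop) (A T : set I) x y :
  (forall u v, A u -> A v -> r u v -> T u <-> T v) ->
  zigzag r A x y -> T x <-> T y.
Proof.
move=> rT; elim=> {x y} [x y [Ax Ay xy]|x|x y _ xy|x y z _ xy _ yz] //.
- exact: rT.
- by rewrite xy.
- by rewrite xy yz.
Qed.

Lemma count_lt_witness (T : eqType) (a b : pred T) (s : seq T) x :
  subpred a b -> x \in s -> b x -> ~~ a x -> (count a s < count b s)%N.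
Proof.
move=> ab; elim: s => // y s IHs; rewrite inE => /orP[/eqP <-|xs] bx nax /=.
  by rewrite bx (negbTE nax) add0n add1n ltnS; exact: sub_count.
have := IHs xs bx nax; rewrite -addnS => lt_s; apply: leq_add => //.
by case: (boolP (a y)) => // /ab ->.
Qed.

Lemma card_uniq_seq (T : choiceType) (s : seq T) :
  uniq s -> [set` s] #= `I_(size s).
Proof.
elim: s => [_|x s IHs /= /andP[xs us]]; first by rewrite set_nil II0.
apply/eq_cardSP; exists x; first exact: mem_head.
rewrite (_ : _ `\` _ = [set` s]); first exact: IHs.
apply/seteqP; split => y /=; rewrite inE; last first.
  by move=> ys; split; [rewrite ys orbT|move=> yx; rewrite -yx ys in xs].
by move=> [/orP[/eqP//|]].
Qed.

(** * Stages, disconnected points and final subposets *)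

Section PosetFacts.
Context {d : Order.disp_t} {P : porderType d}.
Implicit Types (p q x y : P) (A S : set P).

Local Notation leP := (fun x y : P => is_true (x <= y)).

Definition disconnected S : set P :=
  [set p | ~ poset_connected leP (up p `&` S)].

(** The point [p] is the least element of this set, so any two elements are joined through it. *)
Lemma connected_up p S : S p -> poset_connected leP (up p `&` S).
Proof.
move=> Sp; have Ap : (up p `&` S) p by split => //; exact: lexx.
split; first by exists p.
have toP x : (up p `&` S) x -> zigzag leP (up p `&` S) p x.
  by move=> Ax; apply: rst_step; split => //; case: Ax.
by move=> x y /toP px /toP py; apply: rst_trans py; exact: rst_sym.
Qed.

Lemma stage_mono m n : (m <= n)%N -> stage P m `<=` stage P n.
Proof.
elim: n => [|n IHn]; first by rewrite leqn0 => /eqP ->.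
rewrite leq_eqVlt => /orP[/eqP ->//|]; rewrite ltnS => /IHn mn x /mn Sx.
by left.
Qed.

Lemma stage_constant n :
  disconnected (stage P n) = set0 -> stabilizes_at P n.
Proof.
move=> D0.
have const m : (n <= m)%N -> stage P m = stage P n.
  move=> /subnK <-; elim: (m - n)%N => // k IHk.
  rewrite addSn [LHS]/= IHk -/(disconnected _) D0.
  by apply/seteqP; split => [x [//|[]//]|x]; left.
move=> m nm; apply/seteqP; split => [x Sx|x [k _ Sk]]; first by exists m.
rewrite const // -(const (maxn n k)) ?leq_maxl //.
by apply: stage_mono Sk; exact: leq_maxr.
Qed.

(** Bridge between stages, which are subsets of [P], and finality, which concerns an order on the
    carrier type. *)
Lemma zigzag_full_subposet S p (i j : full_subposet S) :
  zigzag leP (up p `&` S) (val i) (val j) ->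
  zigzag (@sub_le _ _ (full_subposet S))
    [set k | p <= embedding (Q := full_subposet S) k] i j.
Proof.
pose Z := zigzag (@sub_le _ _ (full_subposet S))
  [set k | p <= embedding (Q := full_subposet S) k].
(* Invariant: [y] lifts to an element of the carrier type linked to [i]. *)
pose T := [set y | exists2 k : full_subposet S, val k = y & Z i k].
move=> /(@zigzag_invariant _ _ _ T) h.
have [|[]] := h _.
- move=> u v [pu Su] [pv Sv] uv.
  have step : Z (exist _ u (mem_set Su)) (exist _ v (mem_set Sv)).
    exact: rst_step.
  split=> -[k ku ik].
  + exists (exist _ v (mem_set Sv)) => //; apply: rst_trans step.
    by have <- : k = exist _ u (mem_set Su) by exact: val_inj.
  + exists (exist _ u (mem_set Su)) => //; apply: rst_trans (rst_sym _ _ _ _ step).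
    by have <- : k = exist _ v (mem_set Sv) by exact: val_inj.
- by exists i => //; exact: rst_refl.
- by move=> k /val_inj ->.
Qed.

Lemma final_full_subposet S :
  disconnected S = set0 -> final_subposet (full_subposet S).
Proof.
move=> D0 p.
have [[x [px Sx]] conn] : poset_connected leP (up p `&` S).
  by apply: contrapT => Dp; have : disconnected S p by []; rewrite D0.
split; first by exists (exist _ x (mem_set Sx)).
move=> i j pi pj; apply: zigzag_full_subposet.
by apply: conn; split => //; exact: set_mem (valP _).
Qed.

(* If p is a maximal point of disconnection outside Q, then all q > p in Q have
   connected (up q `&` S), so a zigzag of Q above p glues these into a connected
   (up p `&` S). *)
Lemma final_maximals_disconnected (Q : subposet P) S :
  final_subposet Q -> S `<=` carrier Q -> maximals (disconnected S) `<=` carrier Q.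
Proof.
move=> Qfinal SQ p [Dp pmax]; apply: contrapT => Qp; apply: Dp.
have [[q0 pq0] conn] := Qfinal p.
have above (q : Q) : p <= val q -> poset_connected leP (up (val q) `&` S).
  move=> pq; apply: contrapT => Dq; apply: Qp.
  by rewrite -(pmax (val q)) //; exact: set_mem (valP q).
split.
  have [[x [qx Sx]] _] := above q0 pq0.
  by exists x; split => //; exact: le_trans pq0 qx.
move=> x y [px Sx] [py Sy].
pose x' : Q := exist _ x (mem_set (SQ _ Sx)).
pose y' : Q := exist _ y (mem_set (SQ _ Sy)).
have up_zigzag (q : Q) u v : p <= val q ->
    (up (val q) `&` S) u -> (up (val q) `&` S) v -> zigzag leP (up p `&` S) u v.
  move=> pq qu qv; apply: (@zigzag_sub _ _ (up (val q) `&` S)).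
    by move=> w [qw Sw]; split => //; exact: le_trans pq qw.
  by have [_] := above q pq; exact.
(* Invariant: all of [S] above [q] is linked to [x]. For [u <= v] it passes up by inclusion; it
   passes down because a point of [S] above [v] also lies above [u], where [S] is connected. *)
pose T := [set q : Q |
  forall a, (up (val q) `&` S) a -> zigzag leP (up p `&` S) x a].
have [|+ _] := @zigzag_invariant _ _ _ T x' y' _ (conn x' y' px py).
  move=> u v pu pv /sub_le_incl uv; split=> Tu a [ua Sa].
    by apply: Tu; split => //; exact: le_trans uv ua.
  have [[b [vb Sb]] _] := above v pv.
  have ub : (up (val u) `&` S) b by split => //; exact: le_trans uv vb.
  by apply: rst_trans (Tu b _) _ => //; exact: up_zigzag pu ub _.
apply; last by split => //; exact: lexx.
move=> a; apply: (up_zigzag x') => //.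
by split => //; exact: lexx.
Qed.

Lemma final_stage (Q : subposet P) n :
  final_subposet Q -> stage P n `<=` carrier Q.
Proof.
move=> Qfinal; elim: n => [|n IHn] p /=.
  move=> [_ pmax]; have [[q pq] _] := Qfinal p.
  by rewrite -(pmax (val q)) //; exact: set_mem (valP q).
by move=> [/IHn//|]; exact: final_maximals_disconnected.
Qed.

(** Induction on the number of elements above [p]: passing to a strictly larger [b] loses at least
    [p] itself. *)
Lemma finite_maximal A p : finite_set A -> A p ->
  exists2 m, maximals A m & p <= m.
Proof.
move=> /finite_seqP[s ->]; have [n] := ubnP (count (fun x => p <= x) s).
elim: n p => // n IHn p ltn sp.
have [pmax|nmax] := pselect (maximals [set` s] p); first by exists p.
have [b [sb pb bp]] : exists b, [/\ b \in s, p <= b & b <> p].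
  apply: contrapT => nb; apply: nmax; split => // b sb pb.
  by apply: contrapT => bp; apply: nb; exists b.
suff /IHn/(_ sb)[m mmax bm] : (count (fun x => (b <= x)%O) s < n)%N.
  by exists m => //; exact: le_trans pb bm.
rewrite -ltnS; apply: leq_trans ltn; rewrite ltnS.
apply: (@count_lt_witness _ _ _ _ p) => //.
- by move=> x /=; exact: le_trans.
- by apply/negP => bp'; apply: bp; apply/eqP; rewrite eq_le bp' pb.
Qed.

(** A maximal element of [S] is maximal in [P], since anything above it is again below a point of
    [S]. *)
Lemma below_maximal S : finite_set S -> [set: P] = \bigcup_(s in S) dn s ->
  maximals [set: P] `<=` S /\
  forall p, exists2 m, maximals [set: P] m & p <= m.
Proof.
move=> finS PS; have cover x : exists2 s, S s & x <= s.
  have : [set: P] x by [].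
  by rewrite PS => -[s Ss sx]; exists s.
split.
  move=> m [_ mmax]; have [s Ss ms] := cover m.
  by rewrite -(mmax s).
move=> p; have [s Ss ps] := cover p.
have [m [Sm mmax] sm] := finite_maximal finS Ss.
exists m; last exact: le_trans ps sm.
split=> // b _ mb; have [t St bt] := cover b.
have tm : t = m by apply: mmax => //; exact: le_trans mb bt.
by apply/eqP; rewrite eq_le mb -{1}tm bt.
Qed.

(** * Connectedness above points with few maximal elements *)

Section Admissible.
Hypothesis Hadm : forall A B : set P, lower_piece A -> lower_piece B ->
  A `&` B !=set0 -> maximals (A `&` B) !=set0.
Hypothesis below_max : forall p, exists2 m, maximals [set: P] m & p <= m.

(** Every point of a stage lies below a maximal element, and maximal elements belong to every stage,
    so a separation can be moved up to them. *)
Lemma disconnected_maximals n p : disconnected (stage P n) p ->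
  exists x y, [/\ maximals [set: P] x, maximals [set: P] y, p <= x, p <= y
    & ~ zigzag leP (up p `&` stage P n) x y].
Proof.
move=> Dp; apply: contrapT => nxy; apply: Dp.
have inS m : maximals [set: P] m -> stage P n m by exact: (@stage_mono 0).
have [m mmax pm] := below_max p.
split; first by exists m; split => //; exact: inS.
move=> x y [px Sx] [py Sy].
have [x' xmax xx] := below_max x; have [y' ymax yy] := below_max y.
have px' : p <= x' by exact: le_trans px xx.
have py' : p <= y' by exact: le_trans py yy.
apply: (rst_trans _ _ _ x').
  by apply: rst_step; split => //; split => //; exact: inS.
apply: (rst_trans _ _ _ y').
  by apply: contrapT => nz; apply: nxy; exists x', y'.
by apply/rst_sym/rst_step; split => //; split => //; exact: inS.
Qed.

(** Points added later create no new separation: one is always witnessed by maximal elements, which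
    were already linked. *)
Lemma disconnectedS n : disconnected (stage P n.+1) `<=` disconnected (stage P n).
Proof.
move=> p /disconnected_maximals[x [y [xmax ymax px py nxy]]] [_ conn].
apply: nxy; apply: (@zigzag_sub _ _ (up p `&` stage P n)).
  by move=> z [pz Sz]; split => //; left.
by apply: conn; split => //; exact: (@stage_mono 0).
Qed.

(* Induction on n: if maximal x and y are separated above p in stage n.+1, take a
   maximal common lower bound p' >= p of x and y.  It is also disconnected, hence
   not in stage n.+1, so some b > p' is disconnected in stage n.  But b lies below
   fewer maximal elements, as it misses x or y. *)
Lemma few_maximals_connected (s : seq P) n p :
  maximals [set: P] `<=` [set` s] -> (count (fun m => (p <= m)%O) s <= n.+1)%N ->
  ~ disconnected (stage P n) p.
Proof.
move=> smax; elim: n p => [|n IHn] p.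
  move=> le1 /disconnected_maximals[x [y [xmax ymax px py nxy]]].
  have [xy|xy] := eqVneq x y; first by apply: nxy; rewrite xy; exact: rst_refl.
  (* Distinct [x] and [y] would make the count above [p] at least two; comparing with [pred1 x]
     allows for repetitions in [s]. *)
  have : (count (pred1 x) s < count (fun m => (p <= m)%O) s)%N.
    apply: (@count_lt_witness _ _ _ _ y) => //=; last by rewrite eq_sym.
    - by move=> z /eqP ->.
    - exact: smax.
  have : (0 < count (pred1 x) s)%N.
    by rewrite -has_count has_pred1; exact: smax.
  by move=> c0 /(leq_ltn_trans c0)/leq_trans/(_ le1).
move=> len2 /disconnected_maximals[x [y [xmax ymax px py nxy]]].
(* Condition (ii) is applied to a down-set and an interval, which keeps the maximal element found
   above [p]. *)
have [|||p' [[xp' [yp' pp']] p'max]] := @Hadm (dn x) (dn y `&` up p) _ _ _.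
- by exists x; left.
- by exists y; right; exists p.
- by exists p; split => //; split => //; exact: lexx.
have Dp' : disconnected (stage P n.+1) p'.
  move=> [_ conn]; apply: nxy; apply: (@zigzag_sub _ _ (up p' `&` stage P n.+1)).
    by move=> z [pz Sz]; split => //; exact: le_trans pp' pz.
  by apply: conn; split => //; exact: (@stage_mono 0).
apply: (Dp'); apply: connected_up; right; split; first exact: disconnectedS.
move=> b Db p'b; apply: contrapT => bp'; apply: (IHn b) => //.
rewrite -ltnS; apply: leq_trans len2.
have pb : p <= b by exact: le_trans pp' p'b.
have sub : subpred (fun m => b <= m) (fun m => p <= m).
  by move=> z /= bz; exact: le_trans pb bz.
have [bx|bx] := boolP (b <= x); last first.
  by apply: (@count_lt_witness _ _ _ _ x) => //; exact: smax.
have [byy|byy] := boolP (b <= y); last first.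
  by apply: (@count_lt_witness _ _ _ _ y) => //; exact: smax.
by case: bp'; exact: p'max.
Qed.

End Admissible.

(** A duplicate-free list of the maximal elements has length [l.+1], which bounds the count above
    every [p] at once. *)
Lemma admissible_stabilizes : admissible P ->
  exists2 l, disconnected (stage P l) = set0 & maximals [set: P] #= `I_l.+1.
Proof.
move=> [[p0 _] [S [finS PS]] Hadm].
have [maxS below_max] := below_maximal finS PS.
have /finite_seqP[t tmax] := sub_finite_set maxS finS.
have size_t : maximals [set: P] #= `I_(size (undup t)).
  rewrite tmax; have <- : [set` undup t] = [set` t].
    by apply/seteqP; split => x /=; rewrite mem_undup.
  exact/card_uniq_seq/undup_uniq.
have : (0 < size (undup t))%N.
  have [m mmax _] := below_max p0.
  have : m \in undup t by rewrite mem_undup; move: mmax; rewrite tmax.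
  by case: (undup t).
case st : (size (undup t)) size_t => [//|l] size_t _; exists l => //.
rewrite -subset0 => p; apply: (@few_maximals_connected Hadm below_max (undup t)).
  by rewrite tmax => x /=; rewrite mem_undup.
by rewrite -st; exact: count_size.
Qed.

End PosetFacts.

(* The elements (true, i) are maximal; (false, 0) > (false, 1) > ... is a chain
   with (false, k) < (true, i) iff i <= k.  Stage n adds (false, n) exactly:
   above (false, n.+1), the maximal (true, n.+1) is isolated in stage n. *)
Definition ladder (N : nat) : Type := (bool * 'I_N)%type.

(** * Sharpness of the bound: the ladder poset *)

Section Ladder.
Variable N : nat.
Implicit Types u v w : ladder N.

HB.instance Definition _ := Finite.on (ladder N).

Definition ladder_le u v := (u == v) || ~~ u.1 && (v.2 <= u.2)%N.

Definition rung b i : ladder N := (b, i).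

Lemma ladder_le_refl : reflexive ladder_le.
Proof. by move=> u; rewrite /ladder_le eqxx. Qed.

Lemma ladder_le_anti : antisymmetric ladder_le.
Proof.
move=> u v /andP[/orP[/eqP//|/andP[u1 vu]] /orP[/eqP//|/andP[v1 uv]]].
case: u v u1 vu v1 uv => [[] i] [[] j] //= _ ji _ ij; congr pair.
by apply/val_inj/eqP; rewrite eqn_leq ij ji.
Qed.

Lemma ladder_le_trans : transitive ladder_le.
Proof.
move=> v u w /orP[/eqP->//|/andP[u1 vu]] /orP[/eqP<-|/andP[v1 wv]].
  by rewrite /ladder_le u1 vu orbT.
by rewrite /ladder_le u1 (leq_trans wv vu) orbT.
Qed.

Fact ladder_display : Order.disp_t. Proof. exact: Order.Disp tt tt. Qed.

HB.instance Definition _ := Order.Le_isPOrder.Build ladder_display (ladder N)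
  ladder_le_refl ladder_le_anti ladder_le_trans.

Lemma ladder_leE u v : (u <= v) = (u == v) || ~~ u.1 && (v.2 <= u.2)%N.
Proof. by []. Qed.

Lemma ladder_maximals : maximals [set: ladder N] = [set u : ladder N | u.1].
Proof.
apply/seteqP; split => [[[] i] [_ umax]|[b i] /= -> //] //.
  by have := umax (rung true i) I; rewrite ladder_leE /= leqnn => /(_ isT).
by split => // v _; rewrite ladder_leE /= orbF => /eqP.
Qed.

Lemma card_ladder_maximals : maximals [set: ladder N] #= `I_N.
Proof.
rewrite ladder_maximals -[X in `I_X](size_enum_ord N) -(size_map (rung true)).
rewrite (_ : [set u : ladder N | u.1] = [set` map (rung true) (enum 'I_N)]).
  by apply: card_uniq_seq; rewrite map_inj_uniq ?enum_uniq// => i j [].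
apply/seteqP; split => [[b i] /= ->|_ /= /mapP[i _ ->] //].
by apply/mapP; exists i => //; rewrite mem_enum.
Qed.

(** For [k > 0] the point is in the stage already; for [k = 0] it is not, and only one maximal
    element lies above it. *)
Lemma ladder_connected n (k : 'I_N) : (k <= n)%N ->
  stage (ladder N) n = [set u : ladder N | u.1 || (0 < u.2 <= n)%N] ->
  ~ disconnected (stage (ladder N) n) (rung false k).
Proof.
move=> kn Sn; apply; case k0 : (0 < k)%N.
  by apply: connected_up; rewrite Sn /= k0.
suff -> : up (rung false k) `&` stage (ladder N) n = [set rung true k].
  split; first by exists (rung true k).
  by move=> _ _ -> ->; exact: rst_refl.
rewrite Sn; apply/seteqP; split => [[b i] [] /=|_ ->] /=; last first.
  by split => //=; rewrite /up /= ladder_leE /= leqnn.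
rewrite /up /= ladder_leE /= => /orP[/eqP[<- <-]|ik]; first by rewrite k0.
have -> : i = k.
  apply/val_inj/eqP; rewrite eqn_leq ik /=.
  by apply: leq_trans (leq0n i); rewrite leqNgt k0.
by case: b => //=; rewrite k0.
Qed.

Lemma ladder_disconnected n (k : 'I_N) : (n < k)%N ->
  stage (ladder N) n = [set u : ladder N | u.1 || (0 < u.2 <= n)%N] ->
  disconnected (stage (ladder N) n) (rung false k).
Proof.
move=> nk Sn [_ conn].
have N0 : (0 < N)%N by exact: leq_ltn_trans (leq0n k) (ltn_ord k).
have memA (i : 'I_N) :
    (i <= k)%N -> (up (rung false k) `&` stage (ladder N) n) (rung true i).
  by move=> ik; split; [rewrite /up /= ladder_leE ik orbT|rewrite Sn].
(* Cut off [rung true k]: the lower rungs in the stage have index at most [n < k], so none lies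
   below it, whereas [rung true 0] is a different point. *)
have [|+ _] := @zigzag_invariant _ _ _ (eq (rung true k)) _ _ _
    (conn (rung true k) (rung true (Ordinal N0)) (memA k (leqnn k))
      (memA (Ordinal N0) (leq0n k))).
  move=> u v [_ Su] [_ Sv]; rewrite ladder_leE => /orP[/eqP -> //|/andP[u1 vu]].
  move: Su; rewrite Sn /= (negbTE u1) /= => /andP[_ un].
  split=> E; first by rewrite -E in u1.
  by move: vu; rewrite -E /= => /leq_trans /(_ un); rewrite leqNgt nk.
by case/(_ erefl) => k0; move: nk; rewrite k0.
Qed.

Lemma stage_ladder n :
  stage (ladder N) n = [set u : ladder N | u.1 || (0 < u.2 <= n)%N].
Proof.
elim: n => [|n IHn].
  rewrite /= ladder_maximals; apply/seteqP; split => u /=; first by move=> ->.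
  by rewrite leqn0; case: u.1 => //=; case: (u.2 : nat).
have notD (i : 'I_N) : ~ disconnected (stage (ladder N) n) (rung true i).
  by apply; apply: connected_up; rewrite IHn.
rewrite [LHS]/= -/(disconnected _); apply/seteqP; split => [[b k] []|[b k] /=].
- rewrite IHn /= => /orP[->//|/andP[-> kn]].
  by rewrite orbC (leq_trans kn).
- move=> [Dk kmax]; case: b Dk kmax => //= Dk kmax.
  have nk : (n < k)%N by rewrite ltnNge; apply/negP => /ladder_connected; exact.
  (* The disconnected rung of index [n.+1] lies above [rung false k], so maximality forces
     [k = n.+1]. *)
  have nN : (n.+1 < N)%N by exact: leq_ltn_trans nk (ltn_ord k).
  have := kmax (rung false (Ordinal nN))
    (@ladder_disconnected _ (Ordinal nN) (ltnSn n) IHn).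
  by rewrite ladder_leE /= nk orbT => /(_ isT)[<-] /=.
- case: b => [_|/= /andP[k0]]; first by left; rewrite IHn.
  rewrite leq_eqVlt ltnS => /orP[/eqP kn|kn]; last first.
    by left; rewrite IHn /= k0 kn.
  right; split; first by apply: ladder_disconnected => //; rewrite kn.
  (* A disconnected point above must be a lower rung with [n < j <= k = n.+1]. *)
  move=> [[] j] Dj; first by case: (notD j).
  rewrite ladder_leE /= => /orP[/eqP//|jk]; congr pair.
  apply/val_inj/eqP; rewrite eqn_leq jk /= kn ltnNge.
  by apply/negP => /ladder_connected; exact.
Qed.

Lemma ladder_admissible : (0 < N)%N -> admissible (ladder N).
Proof.
move=> N0; split.
- by exists (rung true (Ordinal N0)).
- exists [set: ladder N]; split; first exact: finite_finset.
  apply/seteqP; split => // u _; exists u => //; exact: lexx.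
- move=> A B _ _ [u ABu].
  have [|m mmax _] := finite_maximal _ ABu; first exact: finite_finset.
  by exists m.
Qed.

(** If [l.+1 < N], the rung of index [l.+1] is in stage [l.+1] but not in stage [l]. *)
Lemma ladder_stabilizes l : stabilizes_at (ladder N) l -> (N <= l.+1)%N.
Proof.
move=> stab; rewrite leqNgt; apply/negP => lN.
have : stage (ladder N) l (rung false (Ordinal lN)).
  by rewrite stab // -(stab l.+1) // stage_ladder /= leqnn.
by rewrite stage_ladder /= ltnn.
Qed.

End Ladder.

(* Since N is the cardinality of the set of maximal elements, (l < N)%N reads
   l <= N - 1, and (N <= l.+1)%N reads N - 1 <= l, without truncated subtraction. *)
Theorem theorem3 :
  (forall (d : Order.disp_t) (P : porderType d), admissible P ->
     [/\ final_subposet (full_subposet (stage_infty P)),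
         forall Q : subposet P, final_subposet Q ->
           stage_infty P `<=` carrier Q
       & exists N : nat, maximals [set: P] #= `I_N /\
           exists l : nat, (l < N)%N /\ stabilizes_at P l])
  /\
  (forall N : nat, (0 < N)%N ->
     exists (d : Order.disp_t) (P : porderType d),
       [/\ admissible P,
           maximals [set: P] #= `I_N
         & forall l : nat, stabilizes_at P l -> (N <= l.+1)%N]).
Proof.
split=> [d P /admissible_stabilizes[l D0 card_max]|N N0].
  have stab := stage_constant D0; split.
  - by apply: final_full_subposet; rewrite -(stab l).
  - by move=> Q Qfinal p [n _]; exact: final_stage.
  - by exists l.+1; split => //; exists l.
exists ladder_display, (ladder N); split.
- exact: ladder_admissible.
- exact: card_ladder_maximals.
- exact: ladder_stabilizes.
Qed.
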